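(* Let $m:\mathbb{R}^c\to\mathbb{R}$ be a function such that (M1) there is $L>0$ with $|m(\mathbf{x})-m(\mathbf{y})|\le L\|\mathbf{x}-\mathbf{y}\|_\infty$ for all $\mathbf{x},\mathbf{y}\in\mathbb{R}^c$, and (M2) there is a function $m_\infty:\mathbb{R}^c\to\mathbb{R}$ with $\lim_{N\to\infty}N^{-1}m(N\mathbf{x})=m_\infty(\mathbf{x})$ for all $\mathbf{x}\in\mathbb{R}^c$. For fixed absolutely continuous distributions $\mathrm{P}_1,\ldots,\mathrm{P}_c$ not depending on $N$, as $N\to\infty$, almost surely, $$N^{-1}T_{N,c}^{\phi,m}\to m_\infty\bigg(\Big(\pi_\ell\sum_{k=1}^\infty b_k(\phi)\|\boldsymbol\gamma_{\ell,k}\|^2\Big)_{\ell=1}^c\bigg),$$ where $\|\cdot\|$ is the Euclidean norm and $\boldsymbol\gamma_{\ell,k}:=(\gamma_{\ell,k,1},\gamma_{\ell,k,2})^\top$ is given by $$\gamma_{\ell,k,r}:=\frac1{\sqrt2}\int_0^{2\pi}g_{k,r}(2\pi H(\theta))\,\mathrm{d}F_\ell(\theta),\qquad r=1,2.$$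
   Context: Setting. Fix $c\ge2$ and absolutely continuous distributions $\mathrm{P}_1,\ldots,\mathrm{P}_c$ on the circle that do not depend on $N$; $F_\ell$ is the cdf of $\mathrm{P}_\ell$ on $[0,2\pi)$ (started at $\theta=0$). For $\ell=1,\ldots,c$, let $\Theta_1^{(\ell)},\Theta_2^{(\ell)},\ldots\in[0,2\pi)$ have distribution $\mathrm{P}_\ell$, with all observations (within and across samples) mutually independent; the $\ell$th sample is $\Theta_1^{(\ell)},\ldots,\Theta_{n_\ell}^{(\ell)}$. $n_\ell\ge2$ for all $\ell$ and $N:=\sum_{\ell=1}^c n_\ell$. Uniform scores. $r_i^{(\ell)}\in\{1,\ldots,N\}$ is the rank of $\Theta_i^{(\ell)}$ in the pooled sample of size $N$ (ties have probability zero) and $c_i^{(\ell)}:=2\pi r_i^{(\ell)}/N$; $\mathbf{c}^{(\ell)}:=(c_1^{(\ell)},\ldots,c_{n_\ell}^{(\ell)})$. Kernel. $\phi:[-1,1]\to\mathbb{R}$ is square integrable with respect to the weight $(1-t^2)^{-1/2}$, with Chebyshev coefficients $b_k(\phi)=\frac{2}{\pi(1+\delta_{k0})}\int_{-1}^1\phi(t)\cos(k\cos^{-1}t)(1-t^2)^{-1/2}\,\mathrm{d}t$ satisfying $b_0(\phi)=0$ and $\sum_{k\ge1}|b_k(\phi)|<\infty$, and $\phi(\cos\theta)=\sum_{k\ge1}b_k(\phi)\cos(k\theta)$ for all $\theta$ (so $\phi$ is continuous). Statistics. $S_{n_\ell}^\phi(\mathbf{c}^{(\ell)}):=\frac1{n_\ell}\sum_{i,j=1}^{n_\ell}\phi(\cos(c_i^{(\ell)}-c_j^{(\ell)}))$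 and $T_{N,c}^{\phi,m}:=m\big(S_{n_1}^\phi(\mathbf{c}^{(1)}),\ldots,S_{n_c}^\phi(\mathbf{c}^{(c)})\big)$. Notation and regime. $g_{k,1}(\theta):=\sqrt2\cos(k\theta)$, $g_{k,2}(\theta):=\sqrt2\sin(k\theta)$. $N\to\infty$ with $c$ fixed and $\pi_{\ell,N}:=n_\ell/N\to\pi_\ell\in(0,1)$ for all $\ell$. $H:=\sum_{\ell=1}^c\pi_\ell F_\ell$. *)

(* Defs.v *)
From HB Require Import structures.
From mathcomp Require Import all_boot all_order all_algebra finmap.
From mathcomp Require Import all_classical all_reals all_analysis.
Set Implicit Arguments.
Unset Strict Implicit.
Unset Printing Implicit Defensive.
Import Order.TTheory GRing.Theory Num.Theory.
Import numFieldNormedType.Exports.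
Local Open Scope classical_set_scope.
Local Open Scope ring_scope.

Definition mutually_independent d (T : measurableType d) (R : realType)
    (P : probability T R) (I : choiceType) (X : I -> {RV P >-> R}) : Prop :=
  forall (J : {fset I}) (B : I -> set R),
    (forall i, measurable (B i)) ->
    P (\bigcap_(i in [set` J]) (X i @^-1` B i)) =
    (\prod_(i <- J) P (X i @^-1` B i))%E.

(* Angles are represented in [0, 2pi); the cdf starts at the angle 0. *)
Definition circular_cdf (R : realType) (Q : probability R R) (theta : R) : R :=
  fine (Q `[0, theta]%classic).

Definition chebyshev_weight (R : realType) (t : R) : R :=
  (Num.sqrt (1 - t ^+ 2))^-1.

Definition chebyshev_coef (R : realType) (phi : R -> R) (k : nat) : R :=
  2 / (pi * (1 + (k == 0%N)%:R)) *
  \int[lebesgue_measure]_(t in `[-1, 1])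
    (phi t * cos (k%:R * acos t) * chebyshev_weight t).

(* The index r = 0, 1 : 'I_2 stands for the second subscript 1, 2 of g_{k,r}. *)
Definition trig_basis (R : realType) (k : nat) (r : 'I_2) (theta : R) : R :=
  Num.sqrt 2 * (if r == ord0 then cos (k%:R * theta) else sin (k%:R * theta)).

(* The norm `|v| that the library puts on matrices is the sup norm. *)
Definition euclidean_norm (R : realType) (p : nat) (v : 'cV[R]_p) : R :=
  Num.sqrt (\sum_(i < p) v i ord0 ^+ 2).

(* Integration against dF is integration against the law Q with cdf F. *)
Definition gamma_coef (R : realType) (H : R -> R) (Q : probability R R)
    (k : nat) : 'cV[R]_2 :=
  \col_(r < 2) ((Num.sqrt 2)^-1 *
    \int[Q]_(theta in `[0, 2 * pi[) trig_basis k r (2 * pi * H theta)).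

Definition total_size (c : nat) (n : 'I_c -> nat) : nat := (\sum_(l < c) n l)%N.

(* [x l i] is observation i (counted from 0) of sample l, and only those with
   i < n l belong to the pooled sample. Under ties this is the maximal rank. *)
Definition pooled_rank (R : realType) (c : nat) (n : 'I_c -> nat)
    (x : 'I_c -> nat -> R) (l : 'I_c) (i : nat) : nat :=
  (\sum_(l' < c) \sum_(j < n l') (x l' j <= x l i)%R)%N.

Definition uniform_scores (R : realType) (c : nat) (n : 'I_c -> nat)
    (x : 'I_c -> nat -> R) (l : 'I_c) : 'rV[R]_(n l) :=
  \row_(i < n l) (2 * pi * (pooled_rank n x l i)%:R / (total_size n)%:R).

Definition sobolev_stat (R : realType) (phi : R -> R) (p : nat)
    (s : 'rV[R]_p) : R :=
  p%:R^-1 * \sum_(i < p) \sum_(j < p) phi (cos (s ord0 i - s ord0 j)).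

Definition csample_stat (R : realType) (c : nat) (phi : R -> R)
    (m : 'rV[R]_c -> R) (n : 'I_c -> nat) (x : 'I_c -> nat -> R) : R :=
  m (\row_(l < c) sobolev_stat phi (uniform_scores n x l)).

(* Main.v *)
Require Import Defs.
From HB Require Import structures.
From mathcomp Require Import all_boot all_order all_algebra finmap.
From mathcomp Require Import all_classical all_reals all_analysis.
From mathcomp Require Import measurable_realfun ring lra zify.
Import Order.TTheory GRing.Theory Num.Theory.
Import numFieldNormedType.Exports.
Local Open Scope classical_set_scope.
Local Open Scope ring_scope.
Set Implicit Arguments.
Unset Strict Implicit.
Unset Printing Implicit Defensive.

(** Write the scores as c_i = 2 pi H_nu(x_i), where H_nu is the empirical cdf of the
    pooled sample. The cosine expansion of phi and the addition formula give

      S_l / n_l = sum_k b_k ((1/n_l sum_i cos (k c_i))^2 + (1/n_l sum_i sin (k c_i))^2)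

    (sobolev_stat_series, squared_resultantE), so the statistic only depends on the
    empirical trigonometric moments of the scores.

    These moments converge almost surely. The pooled empirical cdf is a mixture of the
    sample empirical cdfs, so it converges to H at any fixed point by the strong law,
    hence uniformly by monotonicity and the uniform continuity of H, which comes from
    absolute continuity (polya_uniform_cvg, circular_cdf_small_increments). Since the
    trigonometric functions are Lipschitz, H_nu may be replaced by H inside the
    moments (scores_trig_mean_cvg); what remains are averages of bounded functions of
    independent observations, whose limits are the integrals defining gamma.

    Every squared moment is at most 1 and the b_k are absolutely summable, so the limit
    can be taken under the sum over k (tannery); multiplying by n_l / N gives the limit
    of S_l / N. The map m enters through its Lipschitz bound, which makes m (N y) / N
    insensitive to an o(1) error in y (lipschitz_rescaled_cvg).

    The strong law is proved for bounded orthogonal variables by second moments along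
    the squares (strong_law_orthogonal); orthogonality of centred functions of
    independent variables comes from the product form of their joint law
    (Rintegral_mul_of_indep). *)

(** * The strong law of large numbers for bounded variables *)

(** By monotone convergence the function sum_k f k has finite integral, so it is
    finite almost everywhere, and the terms of a convergent series tend to 0. This
    replaces the Borel-Cantelli lemma in the strong law below. *)
Lemma summable_integrals_ae_cvg0 (R : realType) (d : measure_display)
    (T : measurableType d) (P : {measure set T -> \bar R})
    (f : nat -> T -> R) (B : R) :
  (forall k, measurable_fun setT (f k)) -> (forall k w, 0 <= f k w) ->
  (forall n, (\sum_(0 <= k < n) \int[P]_w (f k w)%:E <= B%:E)%E) ->
  {ae P, forall w, f k w @[k --> \oo] --> 0}.
Proof.
move=> mf f0 fB.
have mfE k : measurable_fun setT (fun w => (f k w)%:E : \bar R) by exact/measurable_EFinP.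
have f0E k w : setT w -> (0 <= (f k w)%:E)%E by move=> _; rewrite lee_fin.
have Ioo : (\int[P]_w (\sum_(k <oo) (f k w)%:E) < +oo)%E.
  rewrite (integral_nneseries P measurableT mfE f0E).
  apply: (@le_lt_trans _ _ B%:E); last exact: ltry.
  apply: lime_le.
    by apply: is_cvg_nneseries => n _ _; apply: integral_ge0 => w _; exact: f0E.
  exact: nearW.
have mS : measurable_fun setT (fun w => \sum_(k <oo) (f k w)%:E)%E.
  exact: (@ge0_emeasurable_sum _ _ _ setT (fun k w => (f k w)%:E) xpredT
    (fun k w Dw _ => f0E k w Dw) (fun k _ => mfE k)).
have S0 w : (0 <= \sum_(k <oo) (f k w)%:E)%E by apply: nneseries_ge0 => k _ _; exact: f0E.
have Int : P.-integrable setT (fun w => \sum_(k <oo) (f k w)%:E)%E.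
  apply/integrableP; split => //.
  by under eq_integral => w _ do rewrite gee0_abs//.
have := integrable_ae measurableT Int.
apply: filterS => w /(_ I) fin.
apply: cvg_series_cvg_0.
apply: nondecreasing_is_cvgn.
  by apply: nondecreasing_series => n _ _; exact: f0.
exists (fine (\sum_(k <oo) (f k w)%:E)%E) => _ [n _ <-].
rewrite -lee_fin fineK// /series /= -sumEFin.
by apply: nneseries_lim_ge => k _ _; exact: f0E.
Qed.

Lemma sum_inv_sqr_le (R : realType) (n : nat) :
  \sum_(0 <= k < n) (k.+1%:R ^+ 2)^-1 <= 2 :> R.
Proof.
(* The telescoping bound 1/(k+2)^2 <= 1/(k+1) - 1/(k+2). *)
suff : \sum_(0 <= k < n.+1) (k.+1%:R ^+ 2)^-1 <= 2 - n.+1%:R^-1 :> R.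
  rewrite big_nat_recr//= => h.
  by apply: le_trans (le_trans h _); rewrite ?lerDl ?gerBl.
elim: n => [|n IH]; first by rewrite big_nat1 expr1n !invr1; lra.
rewrite big_nat_recr//=.
have h : (n.+2%:R ^+ 2)^-1 <= n.+1%:R^-1 - n.+2%:R^-1 :> R.
  have -> : n.+1%:R^-1 - n.+2%:R^-1 = (n.+1%:R * n.+2%:R)^-1 :> R.
    rewrite -(natr1 n.+1); field.
    by rewrite !nat1r !natr1 !pnatr_eq0.
  by rewrite lef_pV2 ?posrE ?mulr_gt0// ?exprn_gt0// expr2 ler_wpM2r// ler_nat.
by rewrite (le_trans (lerD IH h))// addrA subrK.
Qed.

Lemma between_squares (n : nat) :
  exists k, (k.+1 ^ 2 <= n.+1 < k.+2 ^ 2)%N.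
Proof.
elim: n => [|n [k /andP[kn nk]]]; first by exists 0%N.
have [h|h] := ltnP n.+2 (k.+2 ^ 2); first by exists k; rewrite h andbT ltnW.
by exists k.+1; rewrite h/= (leq_ltn_trans nk)// ltn_sqr.
Qed.

(** For k^2 <= n < (k+1)^2 the sums up to n and up to k^2 differ by at most 2k terms,
    each bounded by C, which is negligible compared with n. *)
Lemma averages_cvg0_of_squares (R : realType) (y : nat -> R) (C : R) :
  (forall i, `|y i| <= C) ->
  (k.+1 ^ 2)%:R^-1 * \sum_(0 <= i < k.+1 ^ 2) y i @[k --> \oo] --> 0 ->
  n%:R^-1 * \sum_(0 <= i < n) y i @[n --> \oo] --> 0.
Proof.
move=> yC ysq.
have C0 : 0 <= C by apply: le_trans (yC 0%N).
apply/cvgr0Pnorm_lt => e e0.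
have e20 : 0 < e / 2 by rewrite divr_gt0.
have /cvgr0Pnorm_lt/(_ _ e20)[K1 _ HK1] := ysq.
have /cvgr0Pnorm_lt/(_ _ e20)[K2 _ HK2] : 2 * C * harmonic k @[k --> \oo] --> (0:R).
  by rewrite -[X in _ --> X](mulr0 (2 * C)); exact: (cvgM (cvg_cst _) cvg_harmonic).
pose K := maxn K1 K2.
(* If (K + 2)^2 <= n + 1 < (k + 2)^2 then K < k, hence the bound K + 2. *)
exists (K.+2 ^ 2)%N => // n /= Kn.
case: n Kn => [|n Kn]; first by rewrite leqn0 expn_eq0.
have [k /andP[kn nk]] := between_squares n.
have Kk : (K <= k)%N.
  by have := leq_ltn_trans Kn nk; rewrite ltn_sqr !ltnS => /ltnW.
have {HK1} := HK1 k (leq_trans (leq_maxl _ _) Kk).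
have {HK2} := HK2 k (leq_trans (leq_maxr _ _) Kk).
rewrite ger0_norm ?mulr_ge0 ?harmonic_ge0// /harmonic/= => h2 h1.
rewrite (@big_cat_nat _ _ _ (k.+1 ^ 2))//=.
rewrite mulrDr (le_lt_trans (ler_normD _ _))//.
rewrite [e]splitr ltr_leD//.
  rewrite (le_lt_trans _ h1)// !normrM ler_wpM2r//.
  by rewrite !ger0_norm// lef_pV2 ?posrE ?ltr0n ?expn_gt0// ler_nat.
rewrite (le_trans _ (ltW h2))//.
rewrite normrM (@ger0_norm _ _^-1)//.
apply: (@le_trans _ _ ((k.+1 ^ 2)%:R^-1 * (C * (2 * k.+1)%:R))); last first.
  rewrite natrM natrX expr2 le_eqVlt; apply/orP; left; apply/eqP; field.
  by rewrite nat1r pnatr_eq0.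
apply: ler_pM => //.
  by rewrite lef_pV2 ?posrE ?ltr0n ?expn_gt0// ler_nat.
apply: (le_trans (ler_norm_sum _ _ _)).
apply: (@le_trans _ _ (\sum_(k.+1 ^ 2 <= i < n.+1) C)); first exact: ler_sum.
rewrite big_const_nat iter_addr_0 -[leLHS]mulr_natr ler_wpM2l// ler_nat.
move: nk; rewrite -![in X in _ -> X]mulnn -!mulnn; lia.
Qed.

Lemma bounded_integrable (R : realType) (d : measure_display)
    (T : measurableType d) (P : probability T R) (f : T -> R) (C : R) :
  measurable_fun setT f -> (forall w, `|f w| <= C) ->
  P.-integrable setT (EFin \o f).
Proof.
move=> mf fC; apply: measurable_bounded_integrable => //.
  by apply: le_lt_trans (probability_le1 P measurableT) (ltry 1).
exists C; split; first exact: num_real.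
by move=> M CM w _ /=; apply: le_trans (fC w) (ltW CM).
Qed.

Section strong_law.
Context (R : realType) (d : measure_display) (T : measurableType d)
  (P : probability T R) (Y : nat -> T -> R) (C : R).
Hypothesis mY : forall i, measurable_fun setT (Y i).
Hypothesis YC : forall i w, `|Y i w| <= C.
Hypothesis Yorth : forall i j, i != j -> \int[P]_w (Y i w * Y j w) = 0.

Let S n w := \sum_(0 <= i < n) Y i w.

Let mS n : measurable_fun setT (S n).
Proof. by apply: measurable_sum => i; exact: mY. Qed.

Let SC n w : `|S n w| <= n%:R * C.
Proof.
apply: (le_trans (ler_norm_sum _ _ _)).
apply: (@le_trans _ _ (\sum_(0 <= i < n) C)); first exact: ler_sum.
by rewrite big_const_nat iter_addr_0 subn0 mulr_natl.
Qed.

Let intM (f g : T -> R) (a b : R) :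
  measurable_fun setT f -> measurable_fun setT g ->
  (forall w, `|f w| <= a) -> (forall w, `|g w| <= b) ->
  P.-integrable setT (EFin \o (fun w => f w * g w)).
Proof.
move=> mf mg fa gb; apply: (@bounded_integrable _ _ _ _ _ (a * b)).
  exact: measurable_funM.
by move=> w; rewrite normrM ler_pM.
Qed.

Let orth_sum n m : (m <= n)%N -> \int[P]_w (Y n w * S m w) = 0.
Proof.
elim: m => [_|m IH mn].
  under eq_Rintegral => w _ do rewrite /S big_nil mulr0.
  by rewrite Rintegral_cst// mul0r.
under eq_Rintegral => w _ do rewrite /S big_nat_recr//= mulrDr.
rewrite RintegralD// ?IH// ?(ltnW mn)// ?Yorth ?addr0 ?gtn_eqF//.
- exact: intM (mY _) (mS _) (YC _) (SC _).
- exact: intM (mY _) (mY _) (YC _) (YC _).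
Qed.

(** Cross terms vanish by orthogonality, so the second moment of a sum grows only
    linearly in the number of terms. *)
Lemma second_moment_le n : \int[P]_w (S n w ^+ 2) <= n%:R * C ^+ 2.
Proof.
elim: n => [|n IH].
  under eq_Rintegral => w _ do rewrite /S big_nil expr0n.
  by rewrite Rintegral_cst// !mul0r.
have i1 : P.-integrable setT (EFin \o (fun w => S n w ^+ 2)).
  exact: intM (mS _) (mS _) (SC _) (SC _).
have i2 : P.-integrable setT (EFin \o (fun w => Y n w * S n w)).
  exact: intM (mY _) (mS _) (YC _) (SC _).
have i3 : P.-integrable setT (EFin \o (fun w => Y n w ^+ 2)).
  exact: intM (mY _) (mY _) (YC _) (YC _).
have i4 : P.-integrable setT (EFin \o (fun w => Y n w * S n w + Y n w * S n w)).
  exact: (@integrableD _ _ _ P setT measurableT (EFin \o _) (EFin \o _) i2 i2).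
have i5 : P.-integrable setT (EFin \o
    (fun w => Y n w * S n w + Y n w * S n w + Y n w ^+ 2)).
  exact: (@integrableD _ _ _ P setT measurableT (EFin \o _) (EFin \o _) i4 i3).
have SE w : S n.+1 w ^+ 2 =
    S n w ^+ 2 + (Y n w * S n w + Y n w * S n w + Y n w ^+ 2).
  by rewrite /S big_nat_recr//=; ring.
under eq_Rintegral => w _ do rewrite SE.
rewrite RintegralD// RintegralD// RintegralD// orth_sum// add0r add0r.
rewrite -natr1 mulrDl mul1r lerD//.
have -> : C ^+ 2 = \int[P]_w (C ^+ 2).
  by rewrite Rintegral_cst//= probability_setT mulr1.
apply: le_Rintegral => //.
  by apply: (@bounded_integrable _ _ _ _ _ `|C ^+ 2|).
move=> w _; rewrite -[leLHS]real_normK ?num_real//.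
by rewrite lerXn2r ?nnegrE// (le_trans _ (YC n w)).
Qed.

(** Strong law by second moments: the mean square of the average of n terms is
    O(1/n), which is summable along the squares n = k^2, and boundedness fills the gaps
    between consecutive squares. *)
Lemma strong_law_orthogonal :
  {ae P, forall w, n%:R^-1 * \sum_(0 <= i < n) Y i w @[n --> \oo] --> 0}.
Proof.
(* V k is the squared average over the first (k + 1)^2 terms; its mean is at most
   C^2 / (k + 1)^2, which is summable. *)
pose V k w := ((k.+1 ^ 2)%:R^-1 * S (k.+1 ^ 2) w) ^+ 2.
have mV k : measurable_fun setT (V k).
  apply: measurable_funX; apply: measurable_funM => //; exact: mS.
have VC k w : `|V k w| <= C ^+ 2.
  have C0 : 0 <= C := le_trans (normr_ge0 _) (YC 0 w).
  rewrite normrX lerXn2r ?nnegrE// normrM ger0_norm// ler_pdivrMl ?ltr0n//.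
have iV k : P.-integrable setT (EFin \o V k) by exact: bounded_integrable (VC k).
have EV k : \int[P]_w V k w <= C ^+ 2 * (k.+1%:R ^+ 2)^-1.
  under eq_Rintegral => w _ do rewrite /V exprMn.
  rewrite RintegralZl//; last exact: intM (mS _) (mS _) (SC _) (SC _).
  rewrite exprVn natrX -exprM -[in X in _ <= X]exprVn.
  apply: (le_trans (ler_wpM2l _ (second_moment_le _))) => //.
  rewrite natrX le_eqVlt; apply/orP; left; apply/eqP.
  by field; rewrite nat1r pnatr_eq0.
have V0 k w : 0 <= V k w by exact: sqr_ge0.
have : {ae P, forall w, V k w @[k --> \oo] --> 0}.
  apply: (@summable_integrals_ae_cvg0 _ _ _ _ _ (C ^+ 2 * 2)) => // n.
  have EVE k : (\int[P]_w (V k w)%:E = (\int[P]_w V k w)%:E)%E.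
    by rewrite /Rintegral fineK//; apply: integrable_fin_num => //; exact: iV.
  under eq_bigr => k _ do rewrite EVE.
  rewrite sumEFin lee_fin (le_trans (ler_sum _ (fun k _ => EV k)))//.
  by rewrite -mulr_sumr ler_wpM2l ?sqr_ge0// sum_inv_sqr_le.
apply: filterS => w V0w.
apply: (@averages_cvg0_of_squares _ _ C) => //.
apply/cvgr0Pnorm_lt => e e0; have e20 : 0 < e ^+ 2 by rewrite exprn_gt0.
have /cvgr0Pnorm_lt/(_ _ e20) := V0w.
apply: filterS => k; rewrite /V normrX ltr_pXn2r ?nnegrE//; exact: ltW.
Qed.

End strong_law.

Lemma pairwise_of_mutually_independent (R : realType) (d : measure_display)
    (T : measurableType d) (P : probability T R) (I : choiceType)
    (X : I -> {RV P >-> R}) (a b : I) (A B : set R) :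
  mutually_independent X -> a != b -> measurable A -> measurable B ->
  P (X a @^-1` A `&` X b @^-1` B) = (P (X a @^-1` A) * P (X b @^-1` B))%E.
Proof.
move=> indX ab mA mB.
have := indX [fset a; b]%fset (fun i => if i == a then A else B).
rewrite big_fsetU1 ?inE//= big_seq_fset1 eqxx (eq_sym b a) (negbTE ab) => <-; last first.
  by move=> i; case: ifP.
congr (P _); apply/seteqP; split => w /=.
  by move=> [wA wB] i /=; rewrite !inE => /orP[/eqP->|/eqP->];
    rewrite ?eqxx// eq_sym (negbTE ab).
move=> h; split.
  by have := h a; rewrite /= !inE eqxx => /(_ isT).
by have := h b; rewrite /= !inE eqxx orbT eq_sym (negbTE ab) => /(_ isT).
Qed.

(** The expectation of f(X) g(Y) is an integral against the joint law, which is the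
    product measure by independence; Fubini then factors it. *)
Lemma Rintegral_mul_of_indep (R : realType) (d : measure_display)
    (T : measurableType d) (P : probability T R) (X Y : {RV P >-> R})
    (f g : R -> R) (a b : R) :
  (forall A B, measurable A -> measurable B ->
    P (X @^-1` A `&` Y @^-1` B) = (P (X @^-1` A) * P (Y @^-1` B))%E) ->
  measurable_fun setT f -> measurable_fun setT g ->
  (forall x, `|f x| <= a) -> (forall x, `|g x| <= b) ->
  \int[P]_w (f (X w) * g (Y w)) =
  (\int[P]_w f (X w)) * (\int[P]_w g (Y w)).
Proof.
move=> XY mf mg fa gb.
pose Z w : R * R := (X w, Y w).
have mZ : measurable_fun setT Z by exact: measurable_fun_pair.
pose mixin := isMeasurableFun.Build _ _ _ _ Z mZ.
pose ZR : {RV P >-> (R * R)%type} := HB.pack Z mixin.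
pose mu := distribution P X; pose nu := distribution P Y.
(* Independence says that the joint law and the product of the laws agree on
   rectangles, hence everywhere. *)
have munu : forall A, measurable A -> (mu \x nu)%E A = distribution P ZR A.
  apply: product_measure_unique => A B mA mB.
  by rewrite -XY.
pose h (z : R * R) := f z.1 * g z.2.
have mh : measurable_fun setT h.
  by apply: measurable_funM; apply: measurableT_comp.
have ih (g' : {measure set (R * R) -> \bar R}) : g' setT = 1%E ->
    g'.-integrable setT (EFin \o h).
  move=> g1; apply: measurable_bounded_integrable => //; first by rewrite g1 ltry.
  exists (a * b); split; first exact: num_real.
  move=> M CM z _ /=; apply: le_trans (ltW CM).
  by rewrite normrM ler_pM.
have E1 : (\int[P]_w (f (X w) * g (Y w))%:E = \int[(mu \x nu)%E]_z (h z)%:E)%E.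
  rewrite (@eq_measure_integral _ _ _ _ (distribution P ZR)).
    rewrite (@integral_distribution _ _ _ _ _ P ZR (EFin \o h))//.
      exact/measurable_EFinP.
    apply: (@bounded_integrable _ _ _ P (h \o ZR) (a * b)).
      exact: measurableT_comp.
    by move=> w; rewrite normrM ler_pM.
  by move=> A mA _; exact: munu.
have iX : P.-integrable setT (EFin \o (f \o X)).
  apply: (@bounded_integrable _ _ _ P (f \o X) a); first exact: measurableT_comp.
  by move=> w; exact: fa.
have iY : P.-integrable setT (EFin \o (g \o Y)).
  apply: (@bounded_integrable _ _ _ P (g \o Y) b); first exact: measurableT_comp.
  by move=> w; exact: gb.
rewrite /Rintegral E1 -integral12_prod_meas1; last first.
  by apply: ih; exact: (etrans (munu _ measurableT) (probability_setT _)).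
rewrite /fubini_F/= /h/=.
under eq_integral => x _.
  rewrite (eq_integral (fun y => (f x)%:E * (g y)%:E)%E); last by move=> y _; rewrite EFinM.
  rewrite integralZl//; last first.
    by apply: (@bounded_integrable _ _ _ nu g b).
  rewrite (@integral_distribution _ _ _ _ _ P Y (EFin \o g))//; last exact/measurable_EFinP.
  over.
have fY : (\int[P]_w ((EFin \o g) \o Y) w)%E \is a fin_num by exact: integrable_fin_num.
rewrite -(fineK fY) integralZr//; last by apply: (@bounded_integrable _ _ _ mu f a).
rewrite (@integral_distribution _ _ _ _ _ P X (EFin \o f))//; last exact/measurable_EFinP.
by rewrite fineM// integrable_fin_num.
Qed.

(** Strong law of large numbers for bounded functions of pairwise independent,
    identically distributed variables: after centring, independence becomes
    orthogonality. *)
Lemma strong_law_bounded (R : realType) (d : measure_display)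
    (T : measurableType d) (P : probability T R) (Q : probability R R)
    (X : nat -> {RV P >-> R}) (f : R -> R) (a : R) :
  (forall i A, measurable A -> distribution P (X i) A = Q A) ->
  (forall i j A B, i != j -> measurable A -> measurable B ->
    P (X i @^-1` A `&` X j @^-1` B) =
    (P (X i @^-1` A) * P (X j @^-1` B))%E) ->
  measurable_fun setT f -> (forall x, `|f x| <= a) ->
  {ae P, forall w,
    n%:R^-1 * \sum_(0 <= i < n) f (X i w) @[n --> \oo] --> \int[Q]_x f x}.
Proof.
move=> XQ Xind mf fa.
set e := \int[Q]_x f x.
have iX j : P.-integrable setT (EFin \o (f \o X j)).
  apply: (@bounded_integrable _ _ _ P (f \o X j) a); first exact: measurableT_comp.
  by move=> w; exact: fa.
have Ee i : \int[P]_w f (X i w) = e.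
  rewrite /e /Rintegral -(@eq_measure_integral _ _ _ _ _ (distribution P (X i))); last first.
    by move=> A mA _; exact: XQ.
  rewrite (@integral_distribution _ _ _ _ _ P (X i) (EFin \o f)) => //.
    exact/measurable_EFinP.
  exact: iX.
pose g x := f x - e.
have mg : measurable_fun setT g by exact: measurable_funB.
have ga x : `|g x| <= a + `|e| by rewrite (le_trans (ler_normB _ _))// lerD2r.
have Eg j : \int[P]_w g (X j w) = 0.
  rewrite RintegralB//.
    by rewrite Ee Rintegral_cst//= probability_setT mulr1 subrr.
- exact: iX.
- by apply: (@bounded_integrable _ _ _ P (cst e) `|e|).
have g_avg : {ae P, forall w,
    n%:R^-1 * \sum_(0 <= i < n) g (X i w) @[n --> \oo] --> 0}.
  apply: (@strong_law_orthogonal _ _ _ P (fun i w => g (X i w)) (a + `|e|)).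
  - by move=> i; exact: measurableT_comp.
  - by move=> i w; exact: ga.
  - move=> i j ij; rewrite (@Rintegral_mul_of_indep _ _ _ P (X i) (X j) g g
      (a + `|e|) (a + `|e|))// ?Eg ?mul0r// => A B mA mB; exact: Xind.
apply: filterS g_avg => w lim0.
rewrite -[X in _ --> X]add0r.
apply: cvg_trans (cvgD lim0 (cvg_cst e)); apply: near_eq_cvg.
(* The averages of g and of f differ by e only when n is positive. *)
exists 1%N => // n /= n0; rewrite ?fctE /= /g sumrB mulrBr.
rewrite [\sum_(0 <= i < n) e]big_const_nat iter_addr_0 subn0 -(mulr_natl e) mulrA.
by rewrite mulVf ?mul1r ?subrK// pnatr_eq0 -lt0n.
Qed.

(** * Distribution functions and uniform convergence *)

(** For a nondecreasing G this is uniform continuity; the one-sided form is the one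
    that arguments by monotonicity produce and consume. *)
Definition uniformly_small_increments (R : realType) (G : R -> R) : Prop :=
  forall e, 0 < e -> exists2 del, 0 < del &
    forall s t, s <= t -> t - s < del -> G t - G s < e.

Lemma circular_cdf_homo (R : realType) (Q : probability R R) :
  {homo circular_cdf Q : s t / s <= t}.
Proof.
move=> s t st; rewrite /circular_cdf fine_le ?fin_num_measure//.
apply: le_measure; rewrite ?inE// => x /=; rewrite !in_itv/= => /andP[-> xs].
exact: le_trans xs st.
Qed.

(** A finite measure that vanishes on Lebesgue-null sets is small on all sets of
    small Lebesgue measure, and an increment of the cdf over (s, t] is at most the
    mass of an interval of length t - s. *)
Lemma circular_cdf_small_increments (R : realType) (Q : probability R R) :
  Q `<< @lebesgue_measure R -> uniformly_small_increments (circular_cdf Q).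
Proof.
move=> Qac e e0.
(* Lebesgue measure lives on a copy of R with another display; lam is the same
   function seen as a measure on the measurable type that carries Q. *)
have [lam lamE] : exists lam : {measure set R -> \bar R},
    lam = @lebesgue_measure R :> (set R -> \bar R).
  have mid : measurable_fun setT (idfun : measurableTypeR R -> R).
    by move=> _ A mA; rewrite setTI.
  by unshelve (exists (pushforward (@lebesgue_measure R)
    (idfun : measurableTypeR R -> R))).
have {}Qac : Q `<< lam by rewrite lamE.
pose nu := charge_of_finite_measure Q.
have [N [M NM]] := Hahn_decomposition nu.
have [del [del0 H]] := @charge_variation_continuous _ _ _ nu _ _ NM lam Qac e e0.
exists del => // s t st tsd.
have mI (x y : itv_bound R) : measurable [set` Interval x y] by [].
have Qst : (Q `]s, t]%classic < e%:E)%E.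
  apply: le_lt_trans (H `]s, t]%classic _ _) => //.
    have := abse_charge_variation NM (mI (BRight s) (BRight t)).
    by rewrite gee0_abs// measure_ge0.
  rewrite lamE lebesgue_measure_itv/= lte_fin.
  by case: ifP => _; rewrite ?lte_fin// -EFinB lte_fin.
have sub : `[0, t]%classic `<=` `[0, s]%classic `|` `]s, t]%classic.
  move=> x /=; rewrite !in_itv/= => /andP[x0 xt].
  by have [xs|sx] := leP x s; [left; rewrite x0|right].
rewrite ltrBlDl -lte_fin /circular_cdf EFinD !fineK ?fin_num_measure//.
apply: (@le_lt_trans _ _ (Q `[0%R, s]%classic + Q `]s, t]%classic)%E); last first.
  by rewrite lteD2lE// fin_num_measure.
apply: le_trans (measureU2 _ _ _) => //.
by apply: le_measure; rewrite ?inE//; exact: measurableU.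
Qed.

Lemma mixture_small_increments (R : realType) (c : nat) (p : 'I_c -> R)
    (F : 'I_c -> R -> R) :
  (forall l, 0 <= p l <= 1) -> (forall l, {homo F l : s t / s <= t}) ->
  (forall l, uniformly_small_increments (F l)) ->
  uniformly_small_increments (fun t => \sum_(l < c) p l * F l t).
Proof.
move=> p01 Fmono Fuc e e0.
have e10 : 0 < e / c.+1%:R by rewrite divr_gt0.
have /choice[del Hdel] : forall l, exists del, 0 < del /\
    forall s t, s <= t -> t - s < del -> F l t - F l s < e / c.+1%:R.
  by move=> l; have [del] := Fuc l _ e10; exists del.
exists (\big[Order.min/1]_(l < c) del l).
  by apply: lt_bigmin => // l _; have [] := Hdel l.
move=> s t st ts; rewrite -sumrB.
apply: (@le_lt_trans _ _ (\sum_(l < c) e / c.+1%:R)).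
  apply: ler_sum => l _; rewrite -mulrBr.
  have /andP[p0 p1] := p01 l.
  have F0 : 0 <= F l t - F l s by rewrite subr_ge0 Fmono.
  apply: le_trans (ler_piMl F0 p1) (ltW _).
  by have [_] := Hdel l; apply => //; apply: lt_le_trans ts _; exact: bigmin_le.
rewrite big_const_ord iter_addr_0 -[ltLHS]mulr_natr -mulrA gtr_pMr//.
by rewrite mulrC ltr_pdivrMr// mul1r ltr_nat.
Qed.

Lemma grid_cell (R : realType) (h t : R) (n : nat) :
  0 <= t -> t <= h * n.+1%:R ->
  exists2 i, (i <= n)%N & h * i%:R <= t <= h * i.+1%:R.
Proof.
move=> t0; elim: n => [tn|n IH tn]; first by exists 0%N; rewrite // mulr0 t0.
have [/IH[i iN it]|nt] := leP t (h * n.+1%:R); first by exists i => //; exact: leqW.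
by exists n.+1 => //; rewrite (ltW nt).
Qed.

(** Polya's theorem: for monotone functions and a uniformly continuous limit,
    convergence at the points of all regular grids of [0, b] is already uniform. Only
    countably many points are involved, which is what allows the hypothesis to be
    obtained almost surely from a strong law at each point. *)
Lemma polya_uniform_cvg (R : realType) (b : R) (Gn : nat -> R -> R) (G : R -> R) :
  0 < b ->
  (forall nu, {homo Gn nu : s t / s <= t}) ->
  uniformly_small_increments G ->
  (forall M i, Gn nu (b / M.+1%:R * i%:R) @[nu --> \oo] -->
    G (b / M.+1%:R * i%:R)) ->
  forall e, 0 < e -> \forall nu \near \oo, forall t, 0 <= t <= b ->
    `|Gn nu t - G t| < e.
Proof.
move=> b0 Gn_homo Guc grid e e0.
have e20 : 0 < e / 2 by rewrite divr_gt0.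
have [del del0 Hdel] := Guc _ e20.
have [M HM] : exists M, b / M.+1%:R < del.
  exists (Num.truncn (b / del)).
  by rewrite ltr_pdivrMr ?ltr0n// mulrC -ltr_pdivrMr// truncnS_gt.
set h := b / M.+1%:R in HM.
have : \forall nu \near \oo, forall i : 'I_M.+2,
    `|Gn nu (h * i%:R) - G (h * i%:R)| < e / 2.
  apply: filter_forall => i.
  by have /cvgrPdist_lt/(_ _ e20) := grid M i; apply: filterS => nu; rewrite distrC.
(* By monotonicity Gn nu t lies between its values at the two ends of the cell of
   t, which are within e / 2 of G there, and G varies by less than e / 2 on the cell. *)
apply: filterS => nu Hnu t /andP[t0 tb].
have [|i iM /andP[it ti]] := @grid_cell _ h t M t0.
  by rewrite /h divfK// pnatr_eq0.
have hi : h * i.+1%:R - h * i%:R < del by rewrite -mulrBr -natrB// subSnn mulr1.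
have Gh := Gn_homo nu.
have G1 : G (h * i.+1%:R) - G t < e / 2.
  by apply: Hdel => //; apply: le_lt_trans hi; rewrite lerD2l lerN2.
have G2 : G t - G (h * i%:R) < e / 2.
  by apply: Hdel => //; apply: le_lt_trans hi; rewrite lerD2r.
have := Hnu (inord i); have := Hnu (inord i.+1).
rewrite !inordK ?ltnS// 1?leqW// !ltr_norml => /andP[a1 a2] /andP[a3 a4].
have c1 := Gh _ _ it; have c2 := Gh _ _ ti.
apply/andP; split; lra.
Qed.

(** * Limits of finite sums, of series and of row vectors *)

Lemma cvg_sumr (R : realType) (I : Type) (r : seq I) (u : I -> nat -> R)
    (l : I -> R) : (forall i, u i n @[n --> \oo] --> l i) ->
  \sum_(i <- r) u i n @[n --> \oo] --> \sum_(i <- r) l i.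
Proof.
move=> ul.
apply: (@cvg_big _ _ +%R 0 xpredT _ _ _ r u l) => //.
exact: add_continuous.
Qed.

(** Dominated convergence for series. The sums s nu are given as limits rather than
    as limn because that is the form in which the kernel expansion provides them. *)
Lemma tannery (R : realType) (b a : nat -> R) (A : nat -> nat -> R) (s : nat -> R) :
  cvgn [series `|b k|]_k ->
  (forall nu k, `|A nu k| <= 1) ->
  (forall k, A nu k @[nu --> \oo] --> a k) ->
  (forall nu, [series b k * A nu k]_k @ \oo --> s nu) ->
  s nu @[nu --> \oo] --> limn [series b k * a k]_k.
Proof.
move=> bsum A1 Aa As.
have a1 k : `|a k| <= 1.
  have h : `|A nu k| @[nu --> \oo] --> `|a k| by apply: cvg_norm; exact: Aa.
  rewrite -(cvg_lim _ h)//; apply: limr_le; last exact: nearW.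
  by apply/cvg_ex; eexists; exact: h.
have ba : cvgn [series b k * a k]_k.
  apply: normed_cvg; apply: series_le_cvg bsum => k //=.
  by rewrite normrM ler_piMr.
set l := limn _.
pose D nu k := A nu k - a k.
have D2 nu k : `|D nu k| <= 2 by rewrite (le_trans (ler_normB _ _))// lerD.
have sl nu : series (fun k => b k * D nu k) @ \oo --> s nu - l.
  have -> : series (fun k => b k * D nu k) =
      [series b k * A nu k]_k - [series b k * a k]_k.
    apply/funext => K; rewrite /series/= !fctE -sumrB.
    by apply: eq_bigr => k _; rewrite /D mulrBr.
  exact: cvgB (As nu) ba.
apply/cvgrPdist_le => e e0; have e4 : 0 < e / 4 by rewrite divr_gt0.
set B := limn [series `|b k|]_k in bsum.
have nds : nondecreasing_seq [series `|b k|]_k.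
  by apply: nondecreasing_series => k _ _; exact: normr_ge0.
(* K splits the series: beyond K the sum of |b k| is at most e / 4 and |D| <= 2;
   below K there are finitely many terms. *)
have [K _ /(_ K (leqnn K)) HK] : \forall K \near \oo,
    `|B - [series `|b k|]_k K| < e / 4.
  by move/cvgrPdist_lt : bsum; apply.
have tail m : (K <= m)%N -> \sum_(K <= k < m) `|b k| <= e / 4.
  move=> Km; apply: le_trans (ltW HK); apply: le_trans (ler_norm _).
  have := nondecreasing_cvgn_le nds bsum m.
  by rewrite -/B /series/= (@big_cat_nat _ _ _ K 0 m)//= -lerBrDl.
have : (\sum_(0 <= k < K) `|b k| * `|D nu k|) @[nu --> \oo] --> (0 : R).
  have h0 : \sum_(0 <= k < K) `|b k| * `|a k - a k| = 0.
    by rewrite big1// => k _; rewrite subrr normr0 mulr0.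
  rewrite -[X in _ --> X]h0.
  apply: (@cvg_sumr _ _ _ (fun k nu => `|b k| * `|D nu k|)
    (fun k => `|b k| * `|a k - a k|)) => k; apply: cvgM; first exact: cvg_cst.
  by apply: cvg_norm; apply: cvgB; [exact: Aa|exact: cvg_cst].
move/cvgr0Pnorm_lt/(_ _ e4); apply: filterS => nu head.
rewrite distrC.
have h : `|series (fun k => b k * D nu k) m| @[m --> \oo] --> `|s nu - l|.
  by apply: cvg_norm; exact: sl.
rewrite -(cvg_lim _ h)//; apply: limr_le.
  by apply/cvg_ex; eexists; exact: h.
exists K => // m /= Km.
rewrite /series/= (@big_cat_nat _ _ _ K 0 m)//= (le_trans (ler_normD _ _))//.
apply: (@le_trans _ _ (e / 4 + e / 4 * 2)); last by lra.
apply: lerD.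
  apply: le_trans (ltW head); apply: le_trans (ler_norm_sum _ _ _) _.
  by apply: le_trans (ler_norm _); apply: ler_sum => k _; rewrite normrM.
apply: le_trans (ler_norm_sum _ _ _) _.
apply: (@le_trans _ _ (\sum_(K <= k < m) `|b k| * 2)).
  by apply: ler_sum => k _; rewrite normrM ler_wpM2l.
by rewrite -mulr_suml ler_wpM2r// tail.
Qed.

Lemma cvg_mx_entries (R : realType) (c : nat) (y : nat -> 'rV[R]_c) (z : 'rV[R]_c) :
  (forall l, y nu ord0 l @[nu --> \oo] --> z ord0 l) -> y @ \oo --> z.
Proof.
move=> yz; apply/cvgrPdist_lt => eps eps0.
have : \forall nu \near \oo, forall l, `|z ord0 l - y nu ord0 l| < eps.
  by apply: filter_forall => l; have /cvgrPdist_lt/(_ _ eps0) := yz l.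
apply: filterS => nu H; suff: mx_norm (z - y nu) < eps by [].
have [->|] := eqVneq (mx_norm (z - y nu)) 0 => //.
by move=> /mx_norm_neq0[[i j] ->] /=; rewrite !mxE ord1.
Qed.

(** Since m is Lipschitz, m (y nu) and m (N z) differ by at most
    L N |y nu / N - z|, which is negligible after division by N; the limit along the
    ray through z is then the definition of minf. *)
Lemma lipschitz_rescaled_cvg (R : realType) (c : nat) (m minf : 'rV[R]_c -> R)
    (L : R) (N : nat -> nat) (y : nat -> 'rV[R]_c) (z : 'rV[R]_c) :
  0 <= L -> (forall x x', `|m x - m x'| <= L * `|x - x'|) ->
  (k%:R^-1 * m (k%:R *: z) @[k --> \oo] --> minf z) ->
  (forall nu, (0 < N nu)%N) -> N nu @[nu --> \oo] --> \oo ->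
  (N nu)%:R^-1 *: y nu @[nu --> \oo] --> z ->
  (N nu)%:R^-1 * m (y nu) @[nu --> \oo] --> minf z.
Proof.
move=> L0 mL mz N0 Noo yz.
have mNz := cvg_comp _ _ Noo mz.
have d0 : L * `|(N nu)%:R^-1 *: y nu - z| @[nu --> \oo] --> 0.
  rewrite -[X in _ --> X](mulr0 L); apply: cvgM; first exact: cvg_cst.
  rewrite -[X in _ --> X](@normr0 _ 'rV[R]_c) -(subrr z).
  by apply: cvg_norm; apply: cvgB => //; exact: cvg_cst.
have dm : (N nu)%:R^-1 * m (y nu) - (N nu)%:R^-1 * m ((N nu)%:R *: z)
    @[nu --> \oo] --> 0.
  apply/norm_cvg0P; apply: (@squeeze_cvgr _ _ _ _ (cst 0) _ _ _ 0 (cvg_cst _) d0).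
  apply: nearW => nu; rewrite normr_ge0/= -mulrBr normrM ger0_norm//.
  rewrite ler_pdivrMl ?ltr0n// (le_trans (mL _ _))// mulrCA ler_wpM2l//.
  have Nn0 : (N nu)%:R != 0 :> R by rewrite pnatr_eq0 -lt0n.
  have -> : y nu - (N nu)%:R *: z = (N nu)%:R *: ((N nu)%:R^-1 *: y nu - z).
    by rewrite scalerBr scalerA divff// scale1r.
  by rewrite normrZ ger0_norm.
rewrite -[X in _ --> X]add0r; apply: cvg_trans (cvgD dm mNz).
by apply: near_eq_cvg; apply: nearW => nu; rewrite ?fctE/= subrK.
Qed.

(** * Trigonometric moments *)

Lemma nonexpansive_of_derive (R : realType) (f df : R -> R) :
  (forall x : R, is_derive x 1 f (df x)) -> (forall x, `|df x| <= 1) ->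
  forall a b, `|f a - f b| <= `|a - b|.
Proof.
move=> fdf df1 a b; wlog ba : a b / b <= a.
  by move=> W; have [/W//|/ltW/W] := leP b a; rewrite distrC (distrC b).
have [|x _ ->] := MVT_segment ba (fun x _ => fdf x).
  apply: continuous_subspaceT => x; apply: differentiable_continuous.
  by apply/derivable1_diffP; have fx := fdf x; exact: ex_derive.
by rewrite normrM ler_piMl.
Qed.

Lemma trig_basis_lipschitz (R : realType) (k : nat) (r : 'I_2) (a b : R) :
  `|trig_basis k r a - trig_basis k r b| <= Num.sqrt 2 * k%:R * `|a - b|.
Proof.
rewrite /trig_basis -mulrBr normrM ger0_norm ?sqrtr_ge0// -mulrA.
rewrite ler_wpM2l ?sqrtr_ge0// -[k%:R in leRHS](@ger0_norm R)// -normrM mulrBr.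
case: ifP => _.
  apply: (@nonexpansive_of_derive _ _ (fun x => - sin x)) => x.
  by rewrite normrN sin_max.
by apply: (@nonexpansive_of_derive _ _ cos) => x; exact: cos_max.
Qed.

Lemma measurable_trig_basis (R : realType) (k : nat) (r : 'I_2) :
  measurable_fun setT (@trig_basis R k r).
Proof.
apply: measurable_funM => //; case: (r == ord0).
  apply: (measurableT_comp (continuous_measurable_fun (@continuous_cos R))).
  exact: measurable_funM.
apply: (measurableT_comp (continuous_measurable_fun (@continuous_sin R))).
exact: measurable_funM.
Qed.

Lemma trig_basis_bounded (R : realType) (k : nat) (r : 'I_2) (t : R) :
  `|trig_basis k r t| <= Num.sqrt 2.
Proof.
rewrite normrM ger0_norm ?sqrtr_ge0// ler_piMr ?sqrtr_ge0//.
by case: ifP => _; [exact: cos_max|exact: sin_max].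
Qed.

Lemma euclidean_norm_sqr (R : realType) (p : nat) (v : 'cV[R]_p) :
  euclidean_norm v ^+ 2 = \sum_(i < p) v i ord0 ^+ 2.
Proof. by rewrite sqr_sqrtr// sumr_ge0// => i _; exact: sqr_ge0. Qed.

(** The factor 1 / sqrt 2 in gamma is the factor 1 / 2 in squared_resultantE, so
    both sides of the main limit are expressed through the same moments. *)
Lemma gamma_coef_sqr (R : realType) (H : R -> R) (Q : probability R R) (k : nat) :
  euclidean_norm (gamma_coef H Q k) ^+ 2 = 2^-1 * \sum_(r < 2)
    (\int[Q]_(theta in `[0, 2 * pi[) trig_basis k r (2 * pi * H theta)) ^+ 2.
Proof.
rewrite euclidean_norm_sqr mulr_sumr; apply: eq_bigr => r _.
by rewrite mxE exprMn exprVn sqr_sqrtr.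
Qed.

(** The squared mean resultant length of the sample s of angles at frequency k. *)
Definition squared_resultant (R : realType) (k p : nat) (s : 'rV[R]_p) : R :=
  p%:R ^- 2 * \sum_(i < p) \sum_(j < p) cos (k%:R * (s ord0 i - s ord0 j)).

(** The addition formula for cos (k (s_i - s_j)) turns the double sum into squared
    norms of the empirical trigonometric moments, which obey laws of large numbers. *)
Lemma squared_resultantE (R : realType) (k p : nat) (s : 'rV[R]_p) :
  squared_resultant k s = 2^-1 *
    \sum_(r < 2) (p%:R^-1 * \sum_(i < p) trig_basis k r (s ord0 i)) ^+ 2.
Proof.
have half r : 2^-1 * (p%:R^-1 * \sum_(i < p) trig_basis k r (s ord0 i)) ^+ 2 =
    p%:R ^- 2 * (\sum_(i < p) (if r == ord0 then cos (k%:R * s ord0 i)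
      else sin (k%:R * s ord0 i))) ^+ 2.
  rewrite /trig_basis -mulr_sumr !exprMn sqr_sqrtr// exprVn.
  by rewrite mulrCA (mulrA 2^-1) mulVf// mul1r.
rewrite mulr_sumr !big_ord_recl big_ord0 addr0 !half/= -mulrDr.
congr (_ * _); rewrite !expr2 !mulr_suml -big_split/=; apply: eq_bigr => i _.
rewrite !mulr_sumr -big_split/=; apply: eq_bigr => j _.
by rewrite mulrBr cosB.
Qed.

Lemma squared_resultant_le1 (R : realType) (k p : nat) (s : 'rV[R]_p) :
  `|squared_resultant k s| <= 1.
Proof.
case: p s => [|p] s; first by rewrite /squared_resultant big_ord0 mulr0 normr0.
rewrite normrM ger0_norm// ler_pdivrMl ?exprn_gt0// mulr1.
apply: le_trans (ler_norm_sum _ _ _) _.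
apply: (@le_trans _ _ (\sum_(i < p.+1) \sum_(j < p.+1) 1)).
  apply: ler_sum => i _; apply: le_trans (ler_norm_sum _ _ _) _.
  by apply: ler_sum => j _; exact: cos_max.
by rewrite !sumr_const card_ord -mulrnA mulnn natrX.
Qed.

(** Summing the cosine expansion of phi over all pairs of scores diagonalizes the
    statistic: frequency k contributes its coefficient times a squared resultant in
    [-1, 1], so the summability of the coefficients dominates uniformly in the sample. *)
Lemma sobolev_stat_series (R : realType) (phi : R -> R) (b : nat -> R)
    (p : nat) (s : 'rV[R]_p) :
  (forall theta, [series b k * cos (k.+1%:R * theta)]_k @ \oo
     --> phi (cos theta)) ->
  [series b k * squared_resultant k.+1 s]_k @ \oo --> p%:R^-1 * sobolev_stat phi s.
Proof.
move=> phib.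
rewrite /sobolev_stat mulrA -expr2 exprVn.
have -> : [series b k * squared_resultant k.+1 s]_k =
    (fun K => p%:R ^- 2 * \sum_(i < p) \sum_(j < p)
      [series b k * cos (k.+1%:R * (s ord0 i - s ord0 j))]_k K).
  apply/funext => K; rewrite /series/= exchange_big/=.
  under [in RHS]eq_bigr => j _ do rewrite exchange_big/=.
  rewrite exchange_big/= mulr_sumr; apply: eq_bigr => k _.
  rewrite /squared_resultant mulrCA; congr (_ * _).
  rewrite exchange_big/= mulr_sumr; apply: eq_bigr => i _.
  by rewrite mulr_sumr; apply: eq_bigr => j _.
apply: cvgM; first exact: cvg_cst.
by do 2 (apply: cvg_sumr => ?); exact: phib.
Qed.

(** * Uniform scores and the pooled empirical distribution function *)

(** The scores are 2 pi times this function at the observations, so that uniform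
    convergence of the pooled empirical cdf linearizes the ranks. *)
Definition pooled_ecdf (R : realType) (c : nat) (n : 'I_c -> nat)
    (x : 'I_c -> nat -> R) (t : R) : R :=
  (\sum_(l < c) \sum_(j < n l) (x l j <= t)%R)%N%:R / (total_size n)%:R.

Lemma uniform_scores_ecdf (R : realType) (c : nat) (n : 'I_c -> nat)
    (x : 'I_c -> nat -> R) (l : 'I_c) (i : 'I_(n l)) :
  uniform_scores n x l ord0 i = 2 * pi * pooled_ecdf n x (x l i).
Proof. by rewrite mxE mulrA. Qed.

Lemma pooled_ecdf_homo (R : realType) (c : nat) (n : 'I_c -> nat)
    (x : 'I_c -> nat -> R) : {homo pooled_ecdf n x : s t / s <= t}.
Proof.
move=> s t st; rewrite ler_wpM2r// ler_nat.
apply: leq_sum => l _; apply: leq_sum => j _.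
by case: (leP (x l j) s) => // /le_trans/(_ st) ->.
Qed.

(** The pooled empirical cdf is the mixture of the sample ones with weights the
    sample proportions, hence it estimates the mixture H of the population cdfs. *)
Lemma pooled_ecdfE (R : realType) (c : nat) (n : 'I_c -> nat)
    (x : 'I_c -> nat -> R) (t : R) : (forall l, (0 < n l)%N) ->
  pooled_ecdf n x t = \sum_(l < c) ((n l)%:R / (total_size n)%:R) *
    ((n l)%:R^-1 * \sum_(0 <= j < n l) ((x l j <= t)%R%:R : R)).
Proof.
move=> n0; rewrite /pooled_ecdf natr_sum mulr_suml; apply: eq_bigr => l _.
rewrite natr_sum big_mkord -[RHS]mulrA [_^-1 * (_ * _)]mulrCA mulVKf.
  by rewrite mulrC.
by rewrite pnatr_eq0 -lt0n.
Qed.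

Section consistency.
Context (R : realType) (c : nat) (Q : 'I_c -> probability R R)
  (n : nat -> 'I_c -> nat) (prop : 'I_c -> R) (x : 'I_c -> nat -> R).
Hypothesis n0 : forall nu l, (0 < n nu l)%N.
Hypothesis n_oo : forall l, n nu l @[nu --> \oo] --> \oo.
Hypothesis n_prop : forall l,
  (n nu l)%:R / (total_size (n nu))%:R @[nu --> \oo] --> prop l.
Hypothesis x_range : forall l i, 0 <= x l i <= 2 * pi.

Let H theta := \sum_(l < c) prop l * circular_cdf (Q l) theta.

Lemma pooled_ecdf_cvg t :
  (forall l, m%:R^-1 * \sum_(0 <= j < m) ((x l j <= t)%R%:R : R) @[m --> \oo]
     --> circular_cdf (Q l) t) ->
  pooled_ecdf (n nu) x t @[nu --> \oo] --> H t.
Proof.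
move=> xt.
under eq_fun do rewrite pooled_ecdfE//.
apply: cvg_sumr => l; apply: cvgM; first exact: n_prop.
exact: (cvg_comp _ _ (n_oo l) (xt l)).
Qed.

(** The score of observation j is 2 pi H_nu(x_j) with H_nu the pooled empirical cdf.
    Replacing H_nu by its uniform limit H costs at most a Lipschitz constant times the
    sup-distance, and leaves an average of one fixed function over the observations. *)
Lemma scores_trig_mean_cvg (l : 'I_c) (k : nat) (r : 'I_2) (e : R) :
  (forall eps, 0 < eps -> \forall nu \near \oo, forall t, 0 <= t <= 2 * pi ->
    `|pooled_ecdf (n nu) x t - H t| < eps) ->
  m%:R^-1 * \sum_(0 <= j < m) trig_basis k r (2 * pi * H (x l j)) @[m --> \oo]
    --> e ->
  (n nu l)%:R^-1 * \sum_(i < n nu l)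
    trig_basis k r (uniform_scores (n nu) x l ord0 i) @[nu --> \oo] --> e.
Proof.
move=> unif mean.
have {mean} := cvg_comp _ _ (n_oo l) mean.
move/cvgrPdist_lt => mean; apply/cvgrPdist_lt => eps eps0.
have eps20 : 0 < eps / 2 by rewrite divr_gt0.
(* L exceeds the Lipschitz constant of t |-> trig_basis k r (2 pi t); the added 1
   keeps it positive when k = 0. *)
pose L := Num.sqrt 2 * k%:R * (2 * pi) + 1 : R.
have pi0 : 0 <= 2 * pi :> R by rewrite mulr_ge0// pi_ge0.
have L0 : 0 < L by rewrite ltr_wpDl// mulr_ge0// mulr_ge0// sqrtr_ge0.
have del0 : 0 < eps / 2 / L by rewrite divr_gt0.
have := unif _ del0; have := mean _ eps20.
apply: filterS2 => nu /= meannu unifnu.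
rewrite [eps]splitr; apply: le_lt_trans (ler_distD _ _ _) (ltr_leD meannu _).
rewrite big_mkord -mulrBr -sumrB normrM ger0_norm// ler_pdivrMl ?ltr0n//.
apply: le_trans (ler_norm_sum _ _ _) _.
rewrite [leRHS]mulr_natl -[leRHS]iter_addr_0 -[leRHS]big_const_ord.
apply: ler_sum => i _; rewrite uniform_scores_ecdf.
apply: le_trans (trig_basis_lipschitz _ _ _ _) _.
rewrite -mulrBr normrM (ger0_norm pi0) mulrA distrC.
apply: (@le_trans _ _ (L * (eps / 2 / L))).
  apply: ler_pM => //; first by rewrite mulr_ge0// mulr_ge0// sqrtr_ge0.
    by rewrite lerDl.
  by apply: ltW; apply: unifnu.
by rewrite mulrC divfK// gt_eqF.
Qed.

(** Each squared resultant converges to a squared moment; exchanging this limit with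
    the sum over frequencies is dominated convergence. *)
Lemma sobolev_stat_cvg (phi : R -> R) (b : nat -> R) (e : nat -> 'I_2 -> R)
    (l : 'I_c) :
  cvgn [series `|b k|]_k ->
  (forall theta, [series b k * cos (k.+1%:R * theta)]_k @ \oo
     --> phi (cos theta)) ->
  (forall k r, (n nu l)%:R^-1 * \sum_(i < n nu l)
     trig_basis k.+1 r (uniform_scores (n nu) x l ord0 i) @[nu --> \oo]
       --> e k r) ->
  (total_size (n nu))%:R^-1 * sobolev_stat phi (uniform_scores (n nu) x l)
    @[nu --> \oo] -->
  prop l * limn [series b k * (2^-1 * \sum_(r < 2) e k r ^+ 2)]_k.
Proof.
move=> bsum phib trige.
have Ae k : squared_resultant k.+1 (uniform_scores (n nu) x l) @[nu --> \oo]
    --> 2^-1 * \sum_(r < 2) e k r ^+ 2.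
  under eq_fun do rewrite squared_resultantE.
  apply: cvgM; first exact: cvg_cst.
  by apply: cvg_sumr => r; apply: cvgM; exact: trige.
have key := tannery bsum (fun nu k => squared_resultant_le1 _ _) Ae
  (fun nu => @sobolev_stat_series _ _ _ _ (uniform_scores (n nu) x l) phib).
apply: cvg_trans (cvgM (@n_prop l) key).
apply: near_eq_cvg; apply: nearW => nu; rewrite ?fctE /=.
by rewrite -mulrA mulrCA mulVKf ?pnatr_eq0 -?lt0n.
Qed.

End consistency.

(** * Almost sure limit of the c-sample statistic *)

Theorem theorem6p1 (R : realType) (d : measure_display) (T : measurableType d)
  (P : probability T R)
  (c : nat) (hc : (2 <= c)%N)
  (Q : 'I_c -> probability R R)
  (hQcircle : forall l, Q l `[0, 2 * pi[%classic = 1%E)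
  (hQac : forall l, Q l `<< @lebesgue_measure R)
  (Theta : 'I_c -> nat -> {RV P >-> R})
  (hTheta_range : forall l i w, 0 <= Theta l i w < 2 * pi)
  (hTheta_law : forall l i (A : set R), measurable A ->
     distribution P (Theta l i) A = Q l A)
  (hTheta_indep :
     mutually_independent (fun p : 'I_c * nat => Theta p.1 p.2))
  (phi : R -> R)
  (hphi_meas : measurable_fun (`[-1, 1]%classic : set R) phi)
  (hphi_L2 : lebesgue_measure.-integrable (`[-1, 1]%classic : set R)
     (fun t => (phi t ^+ 2 * chebyshev_weight t)%:E))
  (hb0 : chebyshev_coef phi 0 = 0)
  (hbsum : cvgn [series `|chebyshev_coef phi k.+1|]_k)
  (hphi_series : forall theta : R,
     [series chebyshev_coef phi k.+1 * cos (k.+1%:R * theta)]_k @ \oo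
       --> phi (cos theta))
  (n : nat -> 'I_c -> nat)
  (hn2 : forall nu l, (2 <= n nu l)%N)
  (hN : total_size (n nu) @[nu --> \oo] --> \oo)
  (prop : 'I_c -> R)
  (hprop01 : forall l, 0 < prop l < 1)
  (hprop : forall l,
     (n nu l)%:R / (total_size (n nu))%:R @[nu --> \oo] --> prop l)
  (m : 'rV[R]_c -> R) (minf : 'rV[R]_c -> R)
  (hM1 : exists2 L : R, 0 < L & forall x y, `|m x - m y| <= L * `|x - y|)
  (hM2 : forall x, N%:R^-1 * m (N%:R *: x) @[N --> \oo] --> minf x) :
  let H theta := \sum_(l < c) prop l * circular_cdf (Q l) theta in
  {ae P, forall w,
    (total_size (n nu))%:R^-1 *
      csample_stat phi m (n nu) (fun l i => Theta l i w) @[nu --> \oo]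
    --> minf (\row_(l < c) (prop l * limn [series chebyshev_coef phi k.+1 *
          euclidean_norm (gamma_coef H (Q l) k.+1) ^+ 2]_k))}.
Proof.
move=> H.
have c0 : (0 < c)%N by exact: leq_trans hc.
have N0 nu : (0 < total_size (n nu))%N.
  rewrite /total_size (bigD1 (Ordinal c0))//= addn_gt0.
  by rewrite (leq_trans _ (hn2 nu _)).
have n0 nu l : (0 < n nu l)%N by exact: leq_trans (hn2 nu l).
(* Sample l eventually makes up more than the fraction prop l / 2 > 0 of the
   pooled sample, so its size is unbounded. *)
have n_oo l : n nu l @[nu --> \oo] --> \oo.
  apply/cvgnyPge => A.
  have p0 : 0 < prop l by have /andP[] := hprop01 l.
  have p20 : prop l / 2 < prop l by rewrite gtr_pMr// invf_lt1// ltr1n.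
  have [B HB] : exists B : nat, A%:R / (prop l / 2) < B%:R :> R.
    by exists (Num.truncn (A%:R / (prop l / 2))).+1; exact: truncnS_gt.
  have Hp : \forall nu \near \oo, prop l / 2 < (n nu l)%:R / (total_size (n nu))%:R.
    by apply: (cvgr_gt (prop l)) => //; exact: hprop.
  have HN : \forall nu \near \oo, (B <= total_size (n nu))%N by move/cvgnyPge : hN; apply.
  move: Hp HN; apply: filterS2 => nu Hp BN.
  rewrite -(ler_nat R).
  have Nr : 0 < (total_size (n nu))%:R :> R by rewrite ltr0n.
  move: Hp; rewrite ltr_pdivlMr// => /ltW; apply: le_trans.
  rewrite mulrC -ler_pdivrMr ?divr_gt0// (le_trans (ltW HB))// ler_nat//.
(* The exceptional null set depends on f; only countably many f are used: the
   indicators of [0, t] for t in the grids, and the trigonometric functions of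
   2 pi H. *)
have slln (l : 'I_c) (f : R -> R) (a : R) : measurable_fun setT f ->
    (forall x, `|f x| <= a) -> {ae P, forall w,
    m%:R^-1 * \sum_(0 <= j < m) f (Theta l j w) @[m --> \oo] --> \int[Q l]_x f x}.
  move=> mf fa; apply: (@strong_law_bounded _ _ _ P (Q l) (Theta l) f a) => //.
    by move=> i A mA; exact: hTheta_law.
  move=> i j A B ij mA mB.
  apply: (@pairwise_of_mutually_independent _ _ _ _ _ _ (l, i) (l, j) A B hTheta_indep) => //.
  by apply: contra ij => /eqP[->].
have Hmono : {homo H : s t / s <= t}.
  move=> s t st; apply: ler_sum => l _; rewrite ler_wpM2l//.
    by have /andP[/ltW] := hprop01 l.
  exact: circular_cdf_homo.
have mH : measurable_fun setT H.
  by apply: nondecreasing_measurable => // s t _ _; exact: Hmono.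
have aecdf : {ae P, forall w, forall l M i,
    m%:R^-1 * \sum_(0 <= j < m) ((Theta l j w <= 2 * pi / M.+1%:R * i%:R)%R%:R : R)
      @[m --> \oo] --> circular_cdf (Q l) (2 * pi / M.+1%:R * i%:R)}.
  apply: filter_forall => l; apply: ae_foralln => M; apply: ae_foralln => i.
  set t := _ * i%:R.
  have m0t : measurable `[0, t]%classic by [].
  have indic1 y : `|(\1_`[0, t]%classic : R -> R) y| <= 1.
    by rewrite indicE; case: (_ \in _); rewrite ?normr1 ?normr0.
  have := slln l _ _ (measurable_indic m0t) indic1.
  have -> : \int[Q l]_x (\1_`[0, t]%classic : R -> R) x = circular_cdf (Q l) t.
    by rewrite /Rintegral integral_indic// setIT.
  apply: filterS => w.
  have E j : (\1_`[0, t]%classic : R -> R) (Theta l j w) = (Theta l j w <= t)%R%:R.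
    by rewrite indicE mem_setE in_itv/=; have /andP[-> _] := hTheta_range l j w.
  by under eq_fun do under eq_bigr do rewrite E.
pose I l k r := \int[Q l]_(theta in `[0, 2 * pi[) trig_basis k r (2 * pi * H theta).
have aetrig : {ae P, forall w, forall l r k,
    m%:R^-1 * \sum_(0 <= j < m) trig_basis k r (2 * pi * H (Theta l j w))
      @[m --> \oo] --> I l k r}.
  apply: filter_forall => l; apply: filter_forall => r; apply: ae_foralln => k.
  (* gamma_coef integrates over [0, 2 pi) and the observations lie there, so f is
     cut off outside. *)
  pose f := (fun theta => trig_basis k r (2 * pi * H theta)) \_ `[0, 2 * pi[%classic.
  have mf : measurable_fun setT f.
    apply/measurable_restrict => //; rewrite setTI; apply: measurable_funTS.
    apply: (measurableT_comp (@measurable_trig_basis R k r)).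
    exact: measurable_funM.
  have fa y : `|f y| <= Num.sqrt 2.
    rewrite /f /patch; case: ifP => _; first exact: trig_basis_bounded.
    by rewrite normr0 sqrtr_ge0.
  have := slln l f _ mf fa.
  have -> : I l k r = \int[Q l]_x f x by rewrite /I Rintegral_mkcond.
  apply: filterS => w.
  have E j : f (Theta l j w) = trig_basis k r (2 * pi * H (Theta l j w)).
    by rewrite /f patchT// mem_setE in_itv/= hTheta_range.
  by under eq_fun do under eq_bigr do rewrite E.
move: hM1 => [L L0 mL].
(* From here on the outcome w is fixed and the argument is deterministic. *)
move: aecdf aetrig; apply: filterS2 => w ecdf trig.
pose x l i := Theta l i w.
have xr l i : 0 <= x l i <= 2 * pi.
  by have /andP[-> /ltW] := hTheta_range l i w.
have pi0 : 0 < 2 * pi :> R by rewrite mulr_gt0// pi_gt0.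
have unif eps : 0 < eps -> \forall nu \near \oo, forall t, 0 <= t <= 2 * pi ->
    `|pooled_ecdf (n nu) x t - H t| < eps.
  apply: (@polya_uniform_cvg _ (2 * pi) (fun nu => pooled_ecdf (n nu) x) H) => //.
  - by move=> nu; exact: pooled_ecdf_homo.
  - apply: mixture_small_increments => [l|l|l].
    + by have /andP[/ltW-> /ltW->] := hprop01 l.
    + exact: circular_cdf_homo.
    + exact: circular_cdf_small_increments (hQac l).
  - by move=> M i; apply: pooled_ecdf_cvg => // l; exact: ecdf.
apply: (lipschitz_rescaled_cvg (ltW L0) mL (hM2 _) N0 hN).
apply: cvg_mx_entries => l.
under eq_fun do rewrite !mxE.
rewrite mxE.
under eq_fun do rewrite gamma_coef_sqr.
apply: (@sobolev_stat_cvg _ _ n prop x n0 hprop phi _ (fun k r => I l k.+1 r)) => // k r.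
apply: (@scores_trig_mean_cvg _ _ Q n prop x n0 n_oo xr l k.+1 r _ unif).
exact: trig.
Qed.
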